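(* Let $n,r\ge1$. The set $\{o_{\underline d}\}_{\underline d}\cup\{k_{\underline d}-o_{\underline d}\}_{\underline d}$, where $\underline d$ runs over $D(n,r)$, is a set of pairwise orthogonal idempotents in $G(n,r)$.
   Context: Generic algebra $G(n,r)$. Let $k$ be an algebraically closed field, $V$ an $r$-dimensional $k$-space, $\mathcal{F}$ the variety of $n$-step flags $f:\{0\}=V_0\subseteq\cdots\subseteq V_n=V$. $\mathrm{GL}(V)$-orbits in $\mathcal{F}\times\mathcal{F}$ (diagonal action) are in bijection with $n\times n$ matrices of non-negative integers with entries summing to $r$ via $A(f,f')_{ij}=\dim(V_{i-1}+V_i\cap V'_j)-\dim(V_{i-1}+V_i\cap V'_{j-1})$; $e_A$ is the orbit with matrix $A$. Let $S(A,A')=\{(f_1,f_2): \exists f\in\mathcal{F},\ (f_1,f)\in e_A,\ (f,f_2)\in e_{A'}\}$; if non-empty it contains a unique $\mathrm{GL}(V)$-orbit open in it (Zariski topology). $G(n,r)$ is the free $\mathbb{Z}$-module with basis the orbits $e_A$ and bilinear associative product $e_A\star e_{A'}$ equal to the open orbit in $S(A,A')$ if $S(A,A')\ne\emptyset$, and $0$ otherwise. $D(n,r)$ is the set of $n$-tuples $\underline d$ of non-negative integers with sum $r$, and $\mathcal{F}_{\underline d}$ is the set of flags with $\dim V_i-\dim V_{i-1}=d_i$ for all $i$. $k_{\underline d}$ is the orbit of $(h,h)$ with $h\in\mathcal{F}_{\underline d}$ (the unique closed orbit in $\mathcal{F}_{\underline d}\times\mathcal{F}_{\underline d}$), and $o_{\underline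 d}$ is the unique open $\mathrm{GL}(V)$-orbit in $\mathcal{F}_{\underline d}\times\mathcal{F}_{\underline d}$. *)

(* Defs.v *)
From HB Require Import structures.
From mathcomp Require Import freeg mpoly.
From mathcomp Require Import all_boot all_order all_algebra.
From mathcomp Require Import boolp classical_sets.

Set Implicit Arguments.
Unset Strict Implicit.
Unset Printing Implicit Defensive.

Import GRing.Theory.

Local Open Scope classical_set_scope.
Local Open Scope ring_scope.

(* D(n,r) *)
Definition dimvec (n r : nat) : set (n.-tuple nat) :=
  [set d : n.-tuple nat | (\sum_(i < n) tnth d i = r)%N].

Arguments dimvec : clear implicits.

Section Flags.
Context {k : closedFieldType} (V : vectType k) (n : nat).

Definition is_flag (f : {ffun 'I_n.+1 -> {vspace V}}) : bool :=
  [&& f ord0 == 0%VS, f ord_max == fullv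
    & [forall i : 'I_n, (f (widen_ord (leqnSn n) i) <= f (lift ord0 i))%VS]].

Record flag := Flag {
  flag_fun :> {ffun 'I_n.+1 -> {vspace V}};
  flagP : is_flag flag_fun }.

HB.instance Definition _ := [isSub for flag_fun].
HB.instance Definition _ := [Choice of flag by <:].

Definition flags_of (d : n.-tuple nat) : set flag :=
  [set f : flag | forall i : 'I_n,
    (\dim (f (lift ord0 i)) - \dim (f (widen_ord (leqnSn n) i)) = tnth d i)%N].

Definition GLorbit (p : flag * flag) : set (flag * flag) :=
  [set q : flag * flag | exists2 g : 'End(V), lker g == 0%VS &
    forall i, q.1 i = (g @: p.1 i)%VS /\ q.2 i = (g @: p.2 i)%VS].

Record GLorbits := Orbit {
  orbit_set :> set (flag * flag);
  orbitP : `[< exists p, orbit_set = GLorbit p >] }.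

HB.instance Definition _ := [isSub for orbit_set].
HB.instance Definition _ := [Choice of GLorbits by <:].

(* The Zariski topology on flag * flag is induced by the Plucker embedding of
   each of the 2(n+1) subspaces into P(Lambda V); P(Lambda V) has one homogeneous
   coordinate for each set J of basis vectors of V, and a subspace U only has
   nonzero coordinates at the J of cardinal \dim U. *)
Definition plucker (U : {vspace V}) (J : {set 'I_(\dim {:V})}) : k :=
  if #|J| == \dim U then
    \det (\matrix_(a < #|J|, b < #|J|)
            coord (vbasis {:V}) (enum_val b) (vbasis U)`_a)
  else 0.

(* The factors of the product of projective spaces: inl i for the i-th subspace
   of the first flag, inr i for that of the second one. *)
Definition factor : finType := ('I_n.+1 + 'I_n.+1)%type.

Definition pluckervar : finType := (factor * {set 'I_(\dim {:V})})%type.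

Definition component (p : flag * flag) (s : factor) : {vspace V} :=
  match s with inl i => p.1 i | inr i => p.2 i end.

Definition pluckerpt (p : flag * flag) (v : 'I_#|pluckervar|) : k :=
  plucker (component p (enum_val v).1) (enum_val v).2.

Definition multihomogeneous (P : {mpoly k[#|pluckervar|]}) : Prop :=
  exists e : factor -> nat, forall m, m \in msupp P ->
    forall s : factor,
      (\sum_(J : {set 'I_(\dim {:V})})
         m (enum_rank ((s, J) : pluckervar)) = e s)%N.

Definition zariski_closed (C : set (flag * flag)) : Prop :=
  exists E : set ({mpoly k[#|pluckervar|]}),
    (forall P, E P -> multihomogeneous P) /\
    C = [set p : flag * flag | forall P, E P -> P.@[pluckerpt p] = 0].

Definition open_in (S O : set (flag * flag)) : Prop :=
  exists2 C, zariski_closed C & O = S `\` C.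

(* G(n,r): the basis consists of the orbits themselves, rather than of the
   matrices A that label them. *)
Definition genalg := {freeg GLorbits / int}.

(* The basis element given by the orbit with property Q (for uniquely
   characterised orbits); 0 if there is none. *)
Definition the_orbit (Q : set GLorbits) : genalg :=
  match pselect (exists O, Q O) with
  | left exQ => << projT1 (cid exQ) >>
  | right _ => 0
  end.

Definition compS (O O' : GLorbits) : set (flag * flag) :=
  [set p : flag * flag | exists f, orbit_set O (p.1, f) /\ orbit_set O' (f, p.2)].

(* This is 0 if compS O O' is empty, since orbits are nonempty. *)
Definition star_orbit (O O' : GLorbits) : genalg :=
  the_orbit [set B : GLorbits | open_in (compS O O') B].

Definition star (x y : genalg) : genalg :=
  \sum_(O <- dom x) \sum_(O' <- dom y)
     (coeff O x * coeff O' y) *: star_orbit O O'.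

Definition k_ (d : n.-tuple nat) : genalg :=
  the_orbit [set B : GLorbits | exists2 h, flags_of d h & orbit_set B = GLorbit (h, h)].

Definition o_ (d : n.-tuple nat) : genalg :=
  the_orbit [set B : GLorbits | open_in (flags_of d `*` flags_of d) B].

Definition pairwise_orthogonal_idempotents (E : set genalg) : Prop :=
  (forall x, E x -> star x x = x) /\
  (forall x y, E x -> E y -> x <> y -> star x y = 0).

End Flags.

(* Main.v *)
Require Import Defs.
From mathcomp Require Import freeg mpoly.
From mathcomp Require Import all_boot all_order all_algebra.
From mathcomp Require Import boolp classical_sets.

Set Implicit Arguments.
Unset Strict Implicit.
Unset Printing Implicit Defensive.

Import GRing.Theory.

Local Open Scope classical_set_scope.
Local Open Scope ring_scope.

(** Let F be the set of flags of type [d], K the diagonal of F x F and O an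
    orbit that is open in F x F. Composing with K changes no subset of F x F,
    so K is neutral for O and for itself. The heart of the matter is that
    O * O = O. Then [k_ d] and [o_ d] satisfy kk = k, ko = ok = o and oo = o,
    which makes [o_ d] and [k_ d - o_ d] orthogonal idempotents by
    bilinearity, and products for different types vanish because no flag has
    both types.

    That O * O = O follows from the irreducibility of F and F x F, used twice.
    For [(f1, f2)] in O the flags h such that [(f1, h)] is in O, and those such
    that [(h, f2)] is in O, form two nonempty open subsets of F, which meet:
    hence O is contained in the set S of composable pairs
    ([flag_between], [open_orbit_sub_comp]). So O is open in S, and it meets
    every other nonempty open subset of S, hence is the only orbit open in S
    ([flag_pair_irreducible], [open_orbit_dense]). The same argument shows
    that O is the only open orbit in F x F. Nothing needs to be known about
    the shape of O, or even its existence, as all the identities also hold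
    for [o_ d = 0].

    Irreducibility is proved with lines. A flag is spanned by the initial
    segments of an adapted basis of V, and any two such bases X and Y are
    joined by the line of the X + t (Y - X), which are bases for all but
    finitely many t. Up to a nonzero scalar, which multihomogeneous equations
    do not see ([pluckerpt_frame]), the Plucker coordinates of the flag at t
    are minors of the coordinate matrix of the basis, hence polynomial in t.
    A polynomial equation that fails at one end of the line therefore fails
    at all but finitely many t, so finitely many conditions of this kind hold
    at a common t ([genericM]). *)

(** * Bilinearity of the product *)

Section StarBilinear.
Context {k : closedFieldType} {V : vectType k} {n : nat}.
Implicit Types (x y z : genalg V n) (O : GLorbits V n).

(** The sums over supports that define [star] are linear extensions of maps
    given on the basis, hence additive; this is where bilinearity comes from. *)
Lemma fglift_dom (f : GLorbits V n -> genalg V n) x :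
  \sum_(O <- dom x) coeff O x *: f O = fglift f x.
Proof.
by rewrite -[in RHS](Freeg_dom x) fglift_Freeg /prelift [RHS]big_map.
Qed.

Lemma starE x y : star x y = fglift (fun O => fglift (star_orbit O) y) x.
Proof.
rewrite -fglift_dom /star; apply: eq_bigr => O _.
by rewrite -fglift_dom scaler_sumr; apply: eq_bigr => O' _; rewrite scalerA.
Qed.

Lemma starBl x y z : star (x - y) z = star x z - star y z.
Proof. by rewrite !starE lift_is_additive. Qed.

Lemma starBr x y z : star x (y - z) = star x y - star x z.
Proof.
rewrite !starE -!fglift_dom -sumrB; apply: eq_bigr => O _.
by rewrite lift_is_additive scalerBr.
Qed.

Lemma star0l x : star 0 x = 0.
Proof. by rewrite /star dom0 big_nil. Qed.

Lemma star0r x : star x 0 = 0.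
Proof. by rewrite /star dom0 big1 // => O _; rewrite big_nil. Qed.

Lemma star_basis O O' : star << O >> << O' >> = star_orbit O O'.
Proof. by rewrite starE !liftU !scale1r. Qed.

End StarBilinear.

(** * Polynomial functions on the affine line *)

Section PolynomialFunctions.
Context {k : closedFieldType}.
Implicit Types f g : k -> k.

(** Working with functions that happen to be polynomial, instead of with
    polynomials, lets determinants and evaluations be composed without
    carrying their coefficients over to a polynomial ring. *)
Definition polyfun f : Prop := exists q : {poly k}, forall t, f t = q.[t].

Lemma polyfun_ext f g : f =1 g -> polyfun f -> polyfun g.
Proof. by move=> fg [q fq]; exists q => t; rewrite -fg. Qed.

Lemma polyfun_cst c : polyfun (fun=> c).
Proof. by exists c%:P => t; rewrite hornerC. Qed.

Lemma polyfun_id : polyfun id.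
Proof. by exists 'X => t; rewrite hornerX. Qed.

Lemma polyfunD f g : polyfun f -> polyfun g -> polyfun (fun t => f t + g t).
Proof. by move=> [p fp] [q gq]; exists (p + q) => t; rewrite hornerD fp gq. Qed.

Lemma polyfunM f g : polyfun f -> polyfun g -> polyfun (fun t => f t * g t).
Proof. by move=> [p fp] [q gq]; exists (p * q) => t; rewrite hornerM fp gq. Qed.

Lemma polyfun_sum (I : Type) (s : seq I) (F : I -> k -> k) :
  (forall i, polyfun (F i)) -> polyfun (fun t => \sum_(i <- s) F i t).
Proof.
move=> polyF; elim: s => [|i s IHs].
  by apply: polyfun_ext (polyfun_cst 0) => t; rewrite big_nil.
by apply: polyfun_ext (polyfunD (polyF i) IHs) => t; rewrite big_cons.
Qed.

Lemma polyfun_prod (I : Type) (s : seq I) (F : I -> k -> k) :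
  (forall i, polyfun (F i)) -> polyfun (fun t => \prod_(i <- s) F i t).
Proof.
move=> polyF; elim: s => [|i s IHs].
  by apply: polyfun_ext (polyfun_cst 1) => t; rewrite big_nil.
by apply: polyfun_ext (polyfunM (polyF i) IHs) => t; rewrite big_cons.
Qed.

Lemma polyfunX f m : polyfun f -> polyfun (fun t => f t ^+ m).
Proof. by move=> [q fq]; exists (q ^+ m) => t; rewrite horner_exp fq. Qed.

Lemma polyfun_det m (M : k -> 'M[k]_m) :
  (forall i j, polyfun (fun t => M t i j)) -> polyfun (fun t => \det (M t)).
Proof.
move=> polyM; apply: polyfun_sum => s; apply: polyfunM (polyfun_cst _) _.
exact: polyfun_prod.
Qed.

Lemma polyfun_meval m (P : {mpoly k[m]}) (v : k -> 'I_m -> k) :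
  (forall i, polyfun (v^~ i)) -> polyfun (fun t => P.@[v t]).
Proof.
move=> polyv; apply: polyfun_sum => mon; apply: polyfunM (polyfun_cst _) _.
by apply: polyfun_prod => i; apply: polyfunX.
Qed.

(** A generic function is nonzero on a nonempty open subset of the line. *)
Definition generic f : Prop := polyfun f /\ exists t, f t != 0.

(** Two nonempty open subsets of the line meet: the product of two nonzero
    polynomials is nonzero, and a nonzero polynomial has a nonroot because an
    algebraically closed field is infinite. *)
Lemma genericM f g : generic f -> generic g -> generic (fun t => f t * g t).
Proof.
move=> [polyf [s fs]] [polyg [t gt]]; split; first exact: polyfunM.
have [p fp] := polyf; have [q gq] := polyg.
have /closed_nonrootP[u] : p * q != 0.
  apply: mulf_neq0.
    by apply: contraNneq fs => p0; rewrite fp p0 horner0.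
  by apply: contraNneq gt => q0; rewrite gq q0 horner0.
by rewrite rootE hornerM -fp -gq => ?; exists u.
Qed.

End PolynomialFunctions.

(** * Plucker coordinates computed from an arbitrary basis *)

Section PluckerCoordinates.
Context {k : closedFieldType} {V : vectType k}.
Local Notation e := (vbasis {:V}).
Implicit Types (U : {vspace V}) (X Y : seq V) (J : {set 'I_(\dim {:V})}).

Lemma basis_size U X : basis_of U X -> size X = \dim U.
Proof. by move=> bX; rewrite -(span_basis bX) (eqP (basis_free bX)). Qed.

(** Only the first [#|J|] vectors of [X] enter this minor, so that one sequence
    gives the coordinates of the spans of all its initial segments. *)
Definition plucker_minor X J : k :=
  \det (\matrix_(a < #|J|, b < #|J|) coord e (enum_val b) X`_a).

Definition transition m (X Y : m.-tuple V) : 'M[k]_m :=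
  \matrix_(a, b) coord Y b X`_a.

Lemma transition_inv U m (X Y : m.-tuple V) :
  basis_of U X -> basis_of U Y -> transition X Y *m transition Y X = 1%:M.
Proof.
move=> bX bY; apply/matrixP => a b; rewrite !mxE -(coord_free _ _ (basis_free bX)).
have XaU : X`_a \in U by rewrite (basis_mem bX) // mem_nth // size_tuple.
rewrite (coord_basis bY XaU) linear_sum /=; apply: eq_bigr => j _.
by rewrite !mxE linearZ.
Qed.

Lemma transition_det U m (X Y : m.-tuple V) :
  basis_of U X -> basis_of U Y -> \det (transition X Y) != 0.
Proof.
move=> bX bY; apply/eqP => det0; move/eqP: (oner_neq0 k); apply.
by rewrite -(det1 k m) -(transition_inv bX bY) det_mulmx det0 mul0r.
Qed.

Lemma plucker_minor_change U m (X Y : m.-tuple V) J :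
  basis_of U X -> basis_of U Y -> #|J| = m ->
  plucker_minor X J = \det (transition X Y) * plucker_minor Y J.
Proof.
move=> bX bY eqm; case: _ / eqm X Y bX bY => X Y bX bY.
rewrite -det_mulmx; congr (\det _); apply/matrixP => a b; rewrite !mxE.
have XaU : X`_a \in U by rewrite (basis_mem bX) // mem_nth // size_tuple.
rewrite (coord_basis bY XaU) linear_sum /=; apply: eq_bigr => j _.
by rewrite !mxE linearZ.
Qed.

(** Changing the basis of a subspace multiplies all its Plucker coordinates by
    the determinant of the transition matrix, a factor that is the same for
    all [J]. *)
Lemma plucker_basis U X :
  basis_of U X -> exists2 c, c != 0 & forall J,
    plucker U J = c * (if #|J| == \dim U then plucker_minor X J else 0).
Proof.
move=> bX; have szX : size X == \dim U by rewrite (basis_size bX).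
have bU := vbasisP U; have bX' : basis_of U (Tuple szX) by [].
exists (\det (transition (vbasis U) (Tuple szX))).
  exact: transition_det bU bX'.
move=> J; rewrite /plucker; case: eqP => [cardJ | _]; last by rewrite mulr0.
exact: (plucker_minor_change bU bX').
Qed.

Definition frame_det X : k :=
  \det (\matrix_(a < \dim {:V}, b < \dim {:V}) coord e b X`_a).

(** Being a basis of [V] is thus the nonvanishing of a polynomial in the
    coordinates of the vectors. *)
Lemma frame_det_neq0 X :
  size X = \dim {:V} -> (frame_det X != 0) = basis_of {:V} X.
Proof.
move/eqP=> szX; pose X' := Tuple szX.
apply/idP/idP => [detX|bX]; last first.
  exact: (transition_det (bX : basis_of {:V} X') (vbasisP {:V})).
suffices freeX : free X by rewrite basisEfree freeX subvf (eqP szX) leqnn.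
apply/(@freeP _ _ _ X') => c sum0 i; rewrite /= in sum0.
have unitX : transition X' e \in unitmx by rewrite unitmxE unitfE.
pose u : 'rV_(\dim {:V}) := \row_a c a.
suffices /rowP/(_ i) : u = 0 by rewrite !mxE.
rewrite -(mulmxK unitX u) (_ : u *m _ = 0) ?mul0mx //.
apply/rowP => b; rewrite !mxE -[RHS](linear0 (coord e b)) -sum0 linear_sum.
by apply: eq_bigr => j _; rewrite !mxE linearZ.
Qed.

End PluckerCoordinates.

Section Rescaling.
Context {k : closedFieldType} {V : vectType k} {n : nat}.
Implicit Types (P : {mpoly k[#|pluckervar V n|]}).

(** Each monomial of [P] has the same total degree [m s] in the coordinates of
    the factor [s], so it gets multiplied by the product of the
    [c s ^+ m s], whatever the monomial. *)
Lemma multihomogeneous_rescale P (c : factor n -> k) :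
  multihomogeneous P -> (forall s, c s != 0) ->
  exists2 a, a != 0 &
    forall w, P.@[fun v => c (enum_val v).1 * w v] = a * P.@[w].
Proof.
move=> [m homP] c0; exists (\prod_s c s ^+ m s).
  by apply/prodf_neq0 => s _; rewrite expf_neq0.
move=> w; rewrite !mevalE mulr_sumr; apply: eq_big_seq => mon monP.
rewrite mulrCA; congr (_ * _).
under eq_bigr => v _ do rewrite exprMn.
rewrite big_split /=; congr (_ * _).
rewrite (reindex (@enum_rank (pluckervar V n))) /=; last first.
  exact/onW_bij/enum_rank_bij.
under [RHS]eq_bigr => s _ do rewrite -(homP mon monP s) expr_sum.
by rewrite pair_bigA; apply: eq_bigr => -[s J] _; rewrite enum_rankK.
Qed.

End Rescaling.

(** * Frames adapted to a flag *)

Section AdaptedFrames.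
Context {k : closedFieldType} {V : vectType k} {n : nat}.
Local Notation e := (vbasis {:V}).
Implicit Types (d : n.-tuple nat) (f g : flag V n) (X Y : seq V).

Definition partial_sum d (i : nat) : nat := sumn (take i d).

Lemma partial_sumS d (i : 'I_n) :
  partial_sum d i.+1 = (partial_sum d i + tnth d i)%N.
Proof.
by rewrite /partial_sum (take_nth 0%N) ?size_tuple // sumn_rcons -tnth_nth.
Qed.

Lemma partial_sum_last d : partial_sum d n = (\sum_(i < n) tnth d i)%N.
Proof.
by rewrite /partial_sum take_oversize ?size_tuple // sumnE big_tuple.
Qed.

Lemma leq_partial_sum d i j :
  (i <= j)%N -> (partial_sum d i <= partial_sum d j)%N.
Proof.
move=> /subnKC <-; rewrite /partial_sum takeD sumn_cat.
exact: leq_addr.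
Qed.

(** A basis of [V] whose initial segments span the steps of the flag. Moving
    the basis moves the flag inside the flags of type [d]. *)
Definition adapted d X f : Prop :=
  basis_of {:V} X /\ forall i : 'I_n.+1, f i = <<take (partial_sum d i) X>>%VS.

Lemma flag0 f : f ord0 = 0%VS.
Proof. by case/and3P: (flagP f) => /eqP. Qed.

Lemma flag_last f : f ord_max = fullv.
Proof. by case/and3P: (flagP f) => _ /eqP. Qed.

Lemma flagS f (i : 'I_n) : (f (widen_ord (leqnSn n) i) <= f (lift ord0 i))%VS.
Proof. by case/and3P: (flagP f) => _ _ /forallP. Qed.

(** A frame is built step by step, by appending to a basis of each step a basis
    of a complement of it in the next one. *)
Lemma adapted_exists d f : flags_of d f -> exists X, adapted d X f.
Proof.
move=> fd.
suffices frame m (ltm : (m < n.+1)%N) : exists X,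
    [/\ basis_of (f (Ordinal ltm)) X, size X = partial_sum d m &
        forall j : 'I_n.+1, (j <= m)%N -> f j = <<take (partial_sum d j) X>>%VS].
  have [X [bX _ fX]] := frame n (ltnSn n); exists X; split.
    by rewrite -(flag_last f) (_ : ord_max = Ordinal (ltnSn n)).
  by move=> j; apply: fX; rewrite -ltnS.
elim: m ltm => [|m IHm] ltm.
  have i0 : Ordinal ltm = ord0 by apply: val_inj.
  exists [::]; split=> [||j].
  - by rewrite i0 flag0 nil_basis.
  - by rewrite /partial_sum take0.
  - rewrite leqn0 => /eqP j0; rewrite (_ : j = ord0) ?flag0 ?span_nil //.
    by apply: val_inj.
have [X [bX szX fX]] := IHm (ltnW ltm).
pose i := Ordinal (ltm : (m < n)%N).
set W := f (Ordinal (ltnW ltm)) in bX; set U := f (Ordinal ltm).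
have W_E : W = f (widen_ord (leqnSn n) i) by congr (f _); apply: val_inj.
have U_E : U = f (lift ord0 i) by congr (f _); apply: val_inj.
have leWU : (W <= U)%VS by rewrite W_E U_E flagS.
have dimW := esym (basis_size bX).
have dimUW : \dim (U :\: W) = tnth d i.
  by rewrite -(fd i) -W_E -U_E -(dimv_cap_compl U W) (capv_idPr leWU) addKn.
have szX' : size (X ++ vbasis (U :\: W)) = partial_sum d m.+1.
  by rewrite size_cat size_tuple dimUW szX (partial_sumS d i).
have bX' : basis_of U (X ++ vbasis (U :\: W)).
  rewrite basisEdim span_cat (span_basis bX) (span_basis (vbasisP _)).
  rewrite addvC addv_diff (addv_idPl leWU) subvv /=.
  by rewrite size_cat size_tuple -(dimv_cap_compl U W) (capv_idPr leWU) dimW.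
exists (X ++ vbasis (U :\: W)); split=> // j.
rewrite leq_eqVlt => /orP[/eqP jm|].
  rewrite jm -szX' take_size (span_basis bX').
  by congr (f _); apply: val_inj.
rewrite ltnS => lejm; rewrite fX // take_cat szX.
(* Here the steps j and m have the same dimension, and [take_cat] leaves an
   empty initial segment of the appended vectors. *)
case: ltnP => // leDj; rewrite (_ : partial_sum d j = partial_sum d m).
  by rewrite subnn take0 cats0 -szX take_size.
by apply/eqP; rewrite eqn_leq leDj leq_partial_sum.
Qed.

Lemma adapted_basis d X f i :
  adapted d X f -> basis_of (f i) (take (partial_sum d i) X).
Proof.
move=> [bX fX]; rewrite /basis_of fX eqxx.
apply: (@catl_free _ _ (drop (partial_sum d i) X)).
by rewrite cat_take_drop (basis_free bX).
Qed.

Lemma dim_adapted d X f i : (\sum_(i < n) tnth d i)%N = \dim {:V} ->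
  adapted d X f -> \dim (f i) = partial_sum d i.
Proof.
move=> sumd adX; rewrite -(basis_size (adapted_basis i adX)) size_takel //.
by rewrite (basis_size adX.1) -sumd -partial_sum_last leq_partial_sum // -ltnS.
Qed.

Lemma flag_of_frame d X : (\sum_(i < n) tnth d i)%N = \dim {:V} ->
  basis_of {:V} X -> exists2 f, flags_of d f & adapted d X f.
Proof.
move=> sumd bX.
have szX := basis_size bX.
pose F := [ffun i : 'I_n.+1 => <<take (partial_sum d i) X>>%VS].
have Fflag : is_flag F.
  apply/and3P; split.
  - by rewrite ffunE /partial_sum take0 take0 span_nil.
  - by rewrite ffunE /= partial_sum_last sumd -szX take_size (span_basis bX).
  - apply/forallP => i; rewrite !ffunE; apply: sub_span => v.
    rewrite -(subnKC (leq_partial_sum d (leqnSn i))) takeD mem_cat => vX.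
    by rewrite /= vX.
have adF : adapted d X (Flag Fflag) by split=> // i; rewrite /= ffunE.
exists (Flag Fflag) => // i.
by rewrite !(dim_adapted _ sumd adF) /= /bump /= add1n partial_sumS addKn.
Qed.

End AdaptedFrames.

(** * Irreducibility of the flags of a given type *)

Section Genericity.
Context {k : closedFieldType} {V : vectType k} {n : nat}.
Local Notation e := (vbasis {:V}).
Implicit Types (d : n.-tuple nat) (f g : flag V n) (X Y : seq V).
Implicit Types (P Q : {mpoly k[#|pluckervar V n|]}).

Definition factor_index (s : factor n) : 'I_n.+1 :=
  match s with inl i => i | inr i => i end.

Definition factor_frame X1 X2 (s : factor n) : seq V :=
  match s with inl _ => X1 | inr _ => X2 end.

(** The Plucker coordinates of a pair of flags as they are read off from
    adapted frames, polynomial in the coordinates of the vectors. *)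
Definition frame_pluckerpt d X1 X2 (v : 'I_#|pluckervar V n|) : k :=
  let: (s, J) := enum_val v in
  if #|J| == partial_sum d (factor_index s)
  then plucker_minor (factor_frame X1 X2 s) J else 0.

(** The frame and the basis [vbasis] of each step differ by a nonzero factor
    on the Plucker coordinates of this step, which a multihomogeneous
    polynomial turns into a global nonzero factor. *)
Lemma pluckerpt_frame d P X1 X2 f1 f2 :
  (\sum_(i < n) tnth d i)%N = \dim {:V} -> multihomogeneous P ->
  adapted d X1 f1 -> adapted d X2 f2 ->
  (P.@[pluckerpt (f1, f2)] != 0) = (P.@[frame_pluckerpt d X1 X2] != 0).
Proof.
move=> sumd homP ad1 ad2.
have rescale s : exists c, c != 0 /\ forall J,
    plucker (component (f1, f2) s) J =
    c * (if #|J| == partial_sum d (factor_index s)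
         then plucker_minor (factor_frame X1 X2 s) J else 0).
  (* The two flags play the same role. *)
  have [X [f [i [-> -> -> ad]]]] : exists X f i,
      [/\ factor_index s = i, component (f1, f2) s = f i,
          factor_frame X1 X2 s = X & adapted d X f].
    by case: s => i; [exists X1, f1, i | exists X2, f2, i].
  have [c c0 cP] := plucker_basis (adapted_basis i ad); exists c; split=> // J.
  rewrite cP (dim_adapted i sumd ad); case: eqP => [cardJ | //]; congr (_ * \det _).
  by apply/matrixP => a b; rewrite !mxE nth_take // -cardJ ltn_ord.
have [c cP] := choice rescale.
have [a a0 aP] := multihomogeneous_rescale homP (fun s => (cP s).1).
have -> : pluckerpt (f1, f2) =
    (fun v => c (enum_val v).1 * frame_pluckerpt d X1 X2 v).
  apply/funext => v; rewrite /pluckerpt /frame_pluckerpt.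
  by case: (enum_val v) => s J /=; rewrite (cP s).2.
by rewrite aP mulf_eq0 (negbTE a0).
Qed.

Definition frame_family (X : k -> seq V) : Prop :=
  forall a b, polyfun (fun t => coord e b (X t)`_a).

Lemma polyfun_minor (X : k -> seq V) J :
  frame_family X -> polyfun (fun t => plucker_minor (X t) J).
Proof.
move=> polyX; apply: polyfun_det => a b.
by apply: polyfun_ext (polyX a (enum_val b)) => t; rewrite mxE.
Qed.

Lemma polyfun_frame_det (X : k -> seq V) :
  frame_family X -> polyfun (fun t => frame_det (X t)).
Proof.
move=> polyX; apply: polyfun_det => a b.
by apply: polyfun_ext (polyX a b) => t; rewrite mxE.
Qed.

Lemma polyfun_frame_eval d P (X1 X2 : k -> seq V) :
  frame_family X1 -> frame_family X2 ->
  polyfun (fun t => P.@[frame_pluckerpt d (X1 t) (X2 t)]).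
Proof.
move=> polyX1 polyX2; apply: polyfun_meval => v; rewrite /frame_pluckerpt /=.
case: (enum_val v) => s J /=; case: (#|J| == _); last exact: polyfun_cst.
by case: s => i; [apply: polyfun_minor polyX1 | apply: polyfun_minor polyX2].
Qed.

(** The affine line through two sequences of vectors; all but finitely many of
    its points are bases when one of them is. *)
Definition frame_line X Y (t : k) : seq V :=
  mkseq (fun i => X`_i + t *: (Y`_i - X`_i)) (\dim {:V}).

Lemma size_frame_line X Y t : size (frame_line X Y t) = \dim {:V}.
Proof. exact: size_mkseq. Qed.

Lemma frame_line0 X Y : size X = \dim {:V} -> frame_line X Y 0 = X.
Proof.
move=> szX; apply: (@eq_from_nth _ 0); rewrite size_frame_line // => i lti.
by rewrite nth_mkseq // scale0r addr0.
Qed.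

Lemma frame_line1 X Y : size Y = \dim {:V} -> frame_line X Y 1 = Y.
Proof.
move=> szY; apply: (@eq_from_nth _ 0); rewrite size_frame_line // => i lti.
by rewrite nth_mkseq // scale1r addrC subrK.
Qed.

Lemma frame_line_family X Y : frame_family (frame_line X Y).
Proof.
move=> a b; have [lta|gea] := ltnP a (\dim {:V}); last first.
  apply: polyfun_ext (polyfun_cst 0) => t.
  by rewrite nth_default ?size_frame_line // linear0.
apply: polyfun_ext (polyfunD (polyfun_cst (coord e b X`_a))
  (polyfunM polyfun_id (polyfun_cst (coord e b (Y`_a - X`_a))))) => t.
by rewrite nth_mkseq // [RHS]linearD /= [in RHS]linearZ.
Qed.

Lemma frame_cst_family X : frame_family (fun=> X).
Proof. by move=> a b; apply: polyfun_cst. Qed.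

Lemma generic_frame_det X Y :
  basis_of {:V} X -> generic (fun t => frame_det (frame_line X Y t)).
Proof.
move=> bX; split; first exact/polyfun_frame_det/frame_line_family.
have szX := basis_size bX.
by exists 0; rewrite frame_line0 // frame_det_neq0.
Qed.

(** Two nonempty basic open sets of pairs of flags of type [d] meet: along the
    line that joins frames of [(f1, f2)], at 0, to frames of [(g1, g2)], at 1,
    both polynomials and both frame determinants are generic, so they are
    nonzero at a common point. *)
Lemma flag_pair_irreducible d P Q f1 f2 g1 g2 :
  (\sum_(i < n) tnth d i)%N = \dim {:V} ->
  multihomogeneous P -> multihomogeneous Q ->
  flags_of d f1 -> flags_of d f2 -> flags_of d g1 -> flags_of d g2 ->
  P.@[pluckerpt (f1, f2)] != 0 -> Q.@[pluckerpt (g1, g2)] != 0 ->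
  exists h1 h2, [/\ flags_of d h1, flags_of d h2,
    P.@[pluckerpt (h1, h2)] != 0 & Q.@[pluckerpt (h1, h2)] != 0].
Proof.
move=> sumd homP homQ f1d f2d g1d g2d Pf Qg.
have [X1 adX1] := adapted_exists f1d; have [X2 adX2] := adapted_exists f2d.
have [Y1 adY1] := adapted_exists g1d; have [Y2 adY2] := adapted_exists g2d.
have szX1 := basis_size adX1.1; have szX2 := basis_size adX2.1.
have szY1 := basis_size adY1.1; have szY2 := basis_size adY2.1.
pose Z1 := frame_line X1 Y1; pose Z2 := frame_line X2 Y2.
have polyev R : polyfun (fun t => R.@[frame_pluckerpt d (Z1 t) (Z2 t)]).
  exact: polyfun_frame_eval (frame_line_family _ _) (frame_line_family _ _).
have genP : generic (fun t => P.@[frame_pluckerpt d (Z1 t) (Z2 t)]).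
  split; first exact: polyev.
  exists 0; rewrite /Z1 /Z2 !frame_line0 //.
  by rewrite -(pluckerpt_frame sumd homP adX1 adX2).
have genQ : generic (fun t => Q.@[frame_pluckerpt d (Z1 t) (Z2 t)]).
  split; first exact: polyev.
  exists 1; rewrite /Z1 /Z2 !frame_line1 //.
  by rewrite -(pluckerpt_frame sumd homQ adY1 adY2).
have genZ := genericM (generic_frame_det Y1 adX1.1) (generic_frame_det Y2 adX2.1).
have [_ [t]] := genericM (genericM genP genQ) genZ.
rewrite !mulf_eq0 !negb_or => /andP[/andP[Pt Qt] /andP[]].
rewrite !frame_det_neq0 ?size_frame_line // => bZ1 bZ2.
have [h1 h1d adh1] := flag_of_frame sumd bZ1.
have [h2 h2d adh2] := flag_of_frame sumd bZ2.
exists h1, h2; split=> //.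
  by rewrite (pluckerpt_frame sumd homP adh1 adh2).
by rewrite (pluckerpt_frame sumd homQ adh1 adh2).
Qed.

(** The flags [h] with [(f1, h)] in the first open set and those with
    [(h, f2)] in the second one both form a nonempty open set, as [f2] and
    [f1] show; on the line that joins frames of [f2], at 0, and [f1], at 1,
    these two sets meet. *)
Lemma flag_between d P Q f1 f2 :
  (\sum_(i < n) tnth d i)%N = \dim {:V} ->
  multihomogeneous P -> multihomogeneous Q ->
  flags_of d f1 -> flags_of d f2 ->
  P.@[pluckerpt (f1, f2)] != 0 -> Q.@[pluckerpt (f1, f2)] != 0 ->
  exists h, [/\ flags_of d h,
    P.@[pluckerpt (f1, h)] != 0 & Q.@[pluckerpt (h, f2)] != 0].
Proof.
move=> sumd homP homQ f1d f2d Pf Qf.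
have [X1 adX1] := adapted_exists f1d; have [X2 adX2] := adapted_exists f2d.
have szX1 := basis_size adX1.1; have szX2 := basis_size adX2.1.
pose Z := frame_line X2 X1.
have genP : generic (fun t => P.@[frame_pluckerpt d X1 (Z t)]).
  split.
    exact: polyfun_frame_eval (frame_cst_family _) (frame_line_family _ _).
  exists 0; rewrite /Z !frame_line0 //.
  by rewrite -(pluckerpt_frame sumd homP adX1 adX2).
have genQ : generic (fun t => Q.@[frame_pluckerpt d (Z t) X2]).
  split.
    exact: polyfun_frame_eval (frame_line_family _ _) (frame_cst_family _).
  exists 1; rewrite /Z !frame_line1 //.
  by rewrite -(pluckerpt_frame sumd homQ adX1 adX2).
have [_ [t]] := genericM (genericM genP genQ) (generic_frame_det X1 adX2.1).
rewrite !mulf_eq0 !negb_or => /andP[/andP[Pt Qt]].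
rewrite frame_det_neq0 ?size_frame_line // => bZ.
have [h hd adh] := flag_of_frame sumd bZ.
exists h; split=> //.
  by rewrite (pluckerpt_frame sumd homP adX1 adh).
by rewrite (pluckerpt_frame sumd homQ adh adX2).
Qed.

End Genericity.

(** * Orbits and open subsets *)

Section Orbits.
Context {k : closedFieldType} {V : vectType k} {n : nat}.
Implicit Types (d : n.-tuple nat) (f g h : flag V n) (p q : flag V n * flag V n).
Implicit Types (A B O : GLorbits V n) (S : set (flag V n * flag V n)).

Lemma GLorbit_refl p : GLorbit p p.
Proof.
exists \1%VF; first by apply/lker0P => u v; rewrite !lfunE.
by move=> i; rewrite !lim1g.
Qed.

Lemma GLorbit_trans p q s : GLorbit p q -> GLorbit q s -> GLorbit p s.
Proof.
move=> [g kg pq] [h kh qs]; exists (h \o g)%VF.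
  move/lker0P: kg => injg; move/lker0P: kh => injh.
  by apply/lker0P => u v; rewrite !lfunE /= => /injh/injg.
by move=> i; rewrite !limg_comp (qs i).1 (qs i).2 (pq i).1 (pq i).2.
Qed.

Lemma GLorbit_sym p q : GLorbit p q -> GLorbit q p.
Proof.
move=> [g kg pq]; exists (g^-1)%VF.
  apply/lker0P; exact: (can_inj (lker0_lfunVK kg)).
by move=> i; rewrite (pq i).1 (pq i).2 -!limg_comp lker0_compVf // !lim1g.
Qed.

Lemma orbitE A p : orbit_set A p -> orbit_set A = GLorbit p.
Proof.
have /asboolP[q ->] := orbitP A => qp; apply/seteqP; split=> s.
  exact/GLorbit_trans/GLorbit_sym.
exact: GLorbit_trans.
Qed.

Lemma orbit_nonempty A : exists p, orbit_set A p.
Proof.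
have /asboolP[p Ap] := orbitP A; exists p; rewrite Ap.
exact: GLorbit_refl.
Qed.

Lemma orbit_eq A B p : orbit_set A p -> orbit_set B p -> A = B.
Proof. by move=> Ap Bp; apply: val_inj; rewrite /= (orbitE Ap) (orbitE Bp). Qed.

Definition orbit_of p : GLorbits V n :=
  Orbit (asboolT (ex_intro _ p (erefl (GLorbit p)))).

Lemma the_orbit_unique (Q : set (GLorbits V n)) A :
  Q A -> (forall B, Q B -> B = A) -> the_orbit Q = << A >>.
Proof.
move=> QA uniqQ; rewrite /the_orbit; case: pselect => [exQ|[]]; last by exists A.
by rewrite (uniqQ _ (projT2 (cid exQ))).
Qed.

Lemma the_orbit_none (Q : set (GLorbits V n)) :
  (forall B, ~ Q B) -> the_orbit Q = 0.
Proof.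
move=> noQ; rewrite /the_orbit; case: pselect => // exQ.
by case: (noQ _ (projT2 (cid exQ))).
Qed.

(** The empty set is closed, as the zero locus of the constant 1. *)
Lemma open_in_self A : open_in A A.
Proof.
exists set0; last by rewrite setD0.
exists [set 1]; split.
  move=> P ->; exists (fun=> 0%N) => m; rewrite msupp1 inE => /eqP -> s.
  by rewrite big1 // => J _; rewrite mnm0E.
apply/seteqP; split=> // p /(_ 1 erefl); rewrite meval1 => /eqP.
by rewrite oner_eq0.
Qed.

Lemma open_in_sub S T A : open_in S A -> A `<=` T -> T `<=` S -> open_in T A.
Proof.
move=> [C zC AE] AT TS; exists C => //; apply/seteqP; split=> p.
  by move=> Ap; split; [apply: AT | move: Ap; rewrite AE => -[]].
by move=> [/TS Sp nC]; rewrite AE.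
Qed.

(** One equation of the closed complement gives a basic open neighbourhood. *)
Lemma open_in_basic S A p : open_in S A -> orbit_set A p ->
  exists P, [/\ multihomogeneous P, P.@[pluckerpt p] != 0 &
    forall q, S q -> P.@[pluckerpt q] != 0 -> orbit_set A q].
Proof.
move=> [C [E [homE ->]] AE]; rewrite AE => -[Sp /existsNP[P /not_implyP[EP /eqP P0]]].
exists P; split; [exact: homE | exact: P0 | move=> q Sq Pq].
by split=> // /(_ P EP) /eqP; apply/negP.
Qed.

Lemma flags_of_img d f g (a : 'End(V)) : lker a == 0%VS ->
  (forall i, g i = (a @: f i)%VS) -> flags_of d f -> flags_of d g.
Proof.
move=> ka gf fd i; rewrite -(fd i) !gf.
by rewrite !limg_dim_eq // (eqP ka) capv0.
Qed.

(** The linear map that sends an adapted frame of [f] to one of [g] does it. *)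
Lemma flags_of_transitive d f g : flags_of d f -> flags_of d g ->
  exists2 a : 'End(V), lker a == 0%VS & forall i, g i = (a @: f i)%VS.
Proof.
move=> /adapted_exists[X [bX fX]] /adapted_exists[Y [bY gY]].
have [a aX] := linear_of_free X Y.
have {aX}/(_ (basis_free bX)) aX := aX.
have {aX} aXY : map (linfun a) X = Y.
  rewrite -[RHS]aX ?(basis_size bX) ?(basis_size bY) //.
  by apply: eq_map => v; rewrite lfunE.
exists (linfun a) => [|i]; last by rewrite fX gY limg_span map_take aXY.
have := limg_ker_dim (linfun a) fullv.
rewrite capfv -[X in (_ @: X)%VS](span_basis bX) limg_span aXY (span_basis bY).
by move/eqP; rewrite -[X in _ == X]add0n eqn_add2r dimv_eq0.
Qed.

End Orbits.

(** * Products of the elements [k_ d] and [o_ d] *)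

Section Products.
Context {k : closedFieldType} {V : vectType k} {n : nat}.
Implicit Types (d : n.-tuple nat) (f g h : flag V n) (p q : flag V n * flag V n).
Implicit Types (A B O : GLorbits V n) (S : set (flag V n * flag V n)).
Implicit Types (x y : genalg V n).

Lemma star_orbit_eq A B O : compS A B = orbit_set O -> star_orbit A B = << O >>.
Proof.
move=> ABO; apply: the_orbit_unique => [|B' [C _ B'E]] /=.
  by rewrite ABO; apply: open_in_self.
have [p B'p] := orbit_nonempty B'; apply: (orbit_eq B'p).
by move: B'p; rewrite B'E ABO => -[].
Qed.

(** Elements that are 0 or basis elements inside the pairs of flags of type
    [d]. Their products for different types vanish, since no flag is of both
    types. *)
Definition supported d x : Prop :=
  x = 0 \/ exists2 A, x = << A >> & orbit_set A `<=` flags_of d `*` flags_of d.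

Lemma star_supported d d' x y :
  supported d x -> supported d' y -> d <> d' -> star x y = 0.
Proof.
move=> [-> _ _|[A -> Ad]]; first exact: star0l.
move=> [-> _|[B -> Bd'] dd']; first exact: star0r.
rewrite star_basis; apply: the_orbit_none => C [C' _ CE].
have [p] := orbit_nonempty C; rewrite CE => -[[f [/Ad[_ fd] /Bd'[fd' _]]] _].
by apply: dd'; apply: eq_from_tnth => i; rewrite -fd -fd'.
Qed.

(** By transitivity the diagonal of the flags of type [d] is a single orbit,
    whatever the flag [h] that is chosen to define it. *)
Lemma k_orbit d h : flags_of d h -> exists2 K, k_ V d = << K >> &
  orbit_set K = [set p | flags_of d p.1 /\ p.1 = p.2].
Proof.
move=> hd.
have diag f : flags_of d f ->
    GLorbit (f, f) = [set p | flags_of d p.1 /\ p.1 = p.2].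
  move=> fd; apply/seteqP; split=> -[p1 p2] /=.
    move=> [a ka pa]; split; first exact: (flags_of_img ka (fun i => (pa i).1) fd).
    by apply/val_inj/ffunP => i; rewrite /= (pa i).1 (pa i).2.
  move=> [p1d <-]; have [a ka p1a] := flags_of_transitive fd p1d.
  by exists a.
exists (orbit_of (h, h)); last exact: diag.
apply: the_orbit_unique => [|B [f fd fE]]; first by exists h.
by apply: val_inj; rewrite /= fE !diag.
Qed.

Lemma k_empty d : (forall h, ~ flags_of d h) -> k_ V d = 0.
Proof. by move=> nod; apply: the_orbit_none => B [h /nod]. Qed.

Lemma o_empty d : (forall h, ~ flags_of d h) -> o_ V d = 0.
Proof.
move=> nod; apply: the_orbit_none => B [C _ BE].
by have [p] := orbit_nonempty B; rewrite BE => -[[/nod]].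
Qed.

(** By irreducibility an open orbit [O] meets every nonempty open subset of a
    set [S] that lies between [O] and all pairs of flags of type [d]; an
    orbit that is open in [S] is therefore [O]. With [S] the set of all pairs
    this is the uniqueness that defines [o_ d], and with [S := compS O O] it
    computes the square of [O]. *)
Lemma open_orbit_dense d S O B : (\sum_(i < n) tnth d i)%N = \dim {:V} ->
  open_in (flags_of d `*` flags_of d) O ->
  orbit_set O `<=` S -> S `<=` flags_of d `*` flags_of d ->
  open_in S B -> B = O.
Proof.
move=> sumd opO OS Sd opB.
have [p Op] := orbit_nonempty O; have [q Bq] := orbit_nonempty B.
have [P [homP Pp PO]] := open_in_basic opO Op.
have [Q [homQ Qq QB]] := open_in_basic opB Bq.
have [p1d p2d] := Sd _ (OS _ Op).
have [q1d q2d] : (flags_of d `*` flags_of d) q.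
  by apply: Sd; case: opB Bq => C _ -> [].
case: p q Op Bq Pp Qq p1d p2d q1d q2d =>
  [p1 p2] [q1 q2] /= Op Bq Pp Qq p1d p2d q1d q2d.
have [h1 [h2 [h1d h2d Ph Qh]]] :=
  flag_pair_irreducible sumd homP homQ p1d p2d q1d q2d Pp Qq.
have Oh : orbit_set O (h1, h2) by apply: PO.
by apply: (@orbit_eq _ _ _ _ _ (h1, h2)) => //; apply: QB => //; apply: OS.
Qed.

(** The alternative [o_ V d = 0] stands for the absence of an open orbit; all
    the identities below hold in that case too. *)
Lemma o_orbit d : (\sum_(i < n) tnth d i)%N = \dim {:V} ->
  o_ V d = 0 \/
  exists2 O, o_ V d = << O >> & open_in (flags_of d `*` flags_of d) O.
Proof.
move=> sumd; have [[O opO]|noO] :=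
  pselect (exists O, open_in (flags_of d `*` flags_of d) (orbit_set O)).
  right; exists O => //; apply: the_orbit_unique => // B opB.
  apply: (open_orbit_dense sumd opO _ _ opB) => //.
  by case: opO => C _ ->; apply: subDsetl.
by left; apply: the_orbit_none => B opB; apply: noO; exists B.
Qed.

Lemma open_orbit_sub_comp d O : (\sum_(i < n) tnth d i)%N = \dim {:V} ->
  open_in (flags_of d `*` flags_of d) O -> orbit_set O `<=` compS O O.
Proof.
move=> sumd opO [p1 p2] Op; have [P [homP Pp PO]] := open_in_basic opO Op.
have [p1d p2d] : (flags_of d `*` flags_of d) (p1, p2).
  by case: opO Op => C _ -> [].
have [h [hd P1 P2]] := flag_between sumd homP homP p1d p2d Pp Pp.
by exists h; split; apply: PO.
Qed.

Lemma k_supported d : supported d (k_ V d).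
Proof.
have [[h hd]|nod] := pselect (exists h : flag V n, flags_of d h); last first.
  by left; apply: k_empty => h hd; apply: nod; exists h.
have [K -> KE] := k_orbit hd; right; exists K => // -[p1 p2].
by rewrite KE => -[/= p1d <-].
Qed.

Lemma o_supported d :
  (\sum_(i < n) tnth d i)%N = \dim {:V} -> supported d (o_ V d).
Proof.
move=> /o_orbit[->|[O -> [C _ OE]]]; [by left | right; exists O => //].
by rewrite OE; apply: subDsetl.
Qed.

(** The diagonal orbit is neutral for the composition of subsets of pairs of
    flags of type [d], and [O] is the open orbit of [compS O O], as [compS O O]
    lies between [O] and all these pairs. *)
Lemma star_ko_table d : (\sum_(i < n) tnth d i)%N = \dim {:V} ->
  [/\ star (k_ V d) (k_ V d) = k_ V d, star (k_ V d) (o_ V d) = o_ V d,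
      star (o_ V d) (k_ V d) = o_ V d & star (o_ V d) (o_ V d) = o_ V d].
Proof.
move=> sumd.
have [[h hd]|nod] := pselect (exists h : flag V n, flags_of d h); last first.
  have nod' h : ~ flags_of d h by move=> hd; apply: nod; exists h.
  by rewrite (k_empty nod') (o_empty nod') star0l.
have [K -> KE] := k_orbit hd.
have KK : star_orbit K K = << K >>.
  apply/star_orbit_eq/seteqP; rewrite KE; split=> -[p1 p2] /=.
    by move=> [f []]; rewrite KE => -[/= p1d ->] [].
  by move=> [p1d <-]; exists p1; rewrite KE.
have [->|[O -> opO]] := o_orbit sumd; rewrite ?star0l ?star0r ?star_basis //.
have Od : orbit_set O `<=` flags_of d `*` flags_of d.
  by case: opO => C _ ->; apply: subDsetl.
split=> //.
- apply/star_orbit_eq/seteqP; split=> -[p1 p2] /=.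
    by move=> [f []]; rewrite KE => -[/= _ ->].
  by move=> Op; have [p1d _] := Od _ Op; exists p1; rewrite KE.
- apply/star_orbit_eq/seteqP; split=> -[p1 p2] /=.
    by move=> [f [Of]]; rewrite KE => -[/= _ <-].
  by move=> Op; have [_ p2d] := Od _ Op; exists p2; rewrite KE.
have OOO := open_orbit_sub_comp sumd opO.
have OOd : compS O O `<=` flags_of d `*` flags_of d.
  by move=> [p1 p2] [f [/Od[p1d _] /Od[_ p2d]]].
apply: the_orbit_unique; first exact: open_in_sub opO OOO OOd.
by move=> B /= opB; apply: open_orbit_dense sumd opO OOO OOd opB.
Qed.

End Products.

Theorem lemma9p6 (k : closedFieldType) (n r : nat) (V : vectType k)
    (n_ge1 : (1 <= n)%N) (r_ge1 : (1 <= r)%N) (dimV : \dim {:V} = r) :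
  pairwise_orthogonal_idempotents
    ([set o_ V d | d in dimvec n r] `|`
     [set k_ V d - o_ V d | d in dimvec n r]).
Proof.
have sums (d : n.-tuple nat) :
    dimvec n r d -> (\sum_(i < n) tnth d i)%N = \dim {:V}.
  by rewrite dimV.
have orth (d d' : n.-tuple nat) : dimvec n r d -> dimvec n r d' -> d <> d' ->
    [/\ star (k_ V d) (k_ V d') = 0, star (k_ V d) (o_ V d') = 0,
        star (o_ V d) (k_ V d') = 0 & star (o_ V d) (o_ V d') = 0].
  move=> /sums sumd /sums sumd' dd'.
  have [kd kd'] := (k_supported (V := V) d, k_supported (V := V) d').
  have [od od'] := (o_supported sumd, o_supported sumd').
  by split; apply: star_supported dd'.
split=> [x|x y].
  move=> [] [d /sums /star_ko_table[kk ko ok oo] <-] //.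
  by rewrite starBl !starBr kk ko ok oo subrr subr0.
move=> [] [d dD <-] [] [d' d'D <-] neq;
  have [dd'|/(orth d d' dD d'D)[kk ko ok oo]] := pselect (d = d');
  rewrite ?(starBl, starBr) ?kk ?ko ?ok ?oo ?subr0 //.
- by rewrite dd' in neq.
- by have [_ _ ok oo] := star_ko_table (sums d dD); rewrite -dd' ok oo subrr.
- by have [_ ko _ oo] := star_ko_table (sums d dD); rewrite -dd' ko oo subrr.
- by rewrite dd' in neq.
Qed.
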